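(* Let $\Delta$ be a connected simplicial complex whose vertices are labelled (possibly with repetitions) by $1,\dots,n$. Then the secant variety $\sigma_2(V_\Delta)$ is isomorphic to the product $\mathbb{C}^n\times\widehat T_\Delta$, where $\widehat T_\Delta$ is the affine cone over the affine toric variety $T_\Delta$.
   Context: A simplicial complex is a finite collection of subsets (simplices) of a vertex set, closed under taking subsets; the empty simplex is included and $\dim\sigma=|\sigma|-1$. Here $\Delta$ is a simplicial complex each of whose vertices carries a label in $\{1,\dots,n\}$, every label being used; repeated labels are allowed. Two simplices with the same multiset of labels are identified, and $N$ denotes the number of distinct simplices after this identification (the empty simplex included). A product $\prod_{i\in\sigma}$ runs over the labels of the vertices of $\sigma$ with multiplicity. The complex $\Delta$ defines the embedding $e_\Delta:\mathbb{C}^n\to\mathbb{C}^N$, $\mathbf t\mapsto(x_\sigma)_{\sigma\in\Delta}$, $x_\sigma=\prod_{i\in\sigma}t_i$ (so $x_\emptyset=1$), and $V_\Delta=\overline{e_\Delta(\mathbb{C}^n)}$ (Zariski closure). Let $\Delta_{\ge 2}$ be the set of simplices of $\Delta$ of dimension at least one. The affine toric variety $T_\Delta\subset\mathbb{C}^{N-n-1}$ is the Zariski closure of the image of $\mathbf t\mapsto(\prod_{i\in\sigma}t_i)_{\sigma\in\Delta_{\ge2}}$. The affine cone $\widehat T_\Delta\subset\mathbb{C}^{N-n-1}$ is the Zariski closure of the image of $(s,\mathbf t)\mapsto(s\prod_{i\in\sigma}t_i)_{\sigma\in\Delta_{\ge2}}$, $s\in\mathbb{C}$, $\mathbf t\in\mathbb{C}^n$.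 The (affine) secant variety $\sigma_2(V_\Delta)\subset\mathbb{C}^N$ is the Zariski closure of the image of the parameterization with $2n+1$ parameters $\pi,t_1,\dots,t_n,u_1,\dots,u_n\in\mathbb{C}$ given by $x_\sigma=\pi\prod_{i\in\sigma}t_i+(1-\pi)\prod_{i\in\sigma}u_i$ for all $\sigma\in\Delta$. *)

(* Defs.v *)
(* MathComp, with classical_sets and reals from MathComp-Analysis. *)
From HB Require Import structures.
From mathcomp Require Import all_boot all_order all_algebra.
From mathcomp Require Import finmap.
From mathcomp Require Import classical_sets reals.
From mathcomp Require Import mpoly.
From mathcomp Require Import complex.

Set Implicit Arguments.
Unset Strict Implicit.
Unset Printing Implicit Defensive.

Import GRing.Theory.
Local Open Scope ring_scope.
Local Open Scope classical_set_scope.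

Section AffineGeometry.
Variable F : fieldType.

(* Affine space with coordinates indexed by a finite type I. *)
Definition affine (I : finType) := {ffun I -> F}.

(* Variable number k of p stands for the coordinate enum_val k : I. *)
Definition poly_eval (I : finType) (p : {mpoly F[#|I|]}) (x : affine I) : F :=
  p.@[fun k => x (enum_val k)].

Definition zariski_closed (I : finType) (X : set (affine I)) : Prop :=
  exists E : set {mpoly F[#|I|]},
    X = [set x : affine I | forall p, E p -> poly_eval p x = 0].

Definition zariski_closure (I : finType) (X : set (affine I)) :
  set (affine I) := smallest (@zariski_closed I) X.

Definition poly_map (I J : finType) (f : J -> {mpoly F[#|I|]})
  (x : affine I) : affine J := [ffun j => poly_eval (f j) x].

(* Isomorphism of closed subvarieties of affine spaces: morphisms are the
   restrictions of polynomial maps between the ambient spaces. *)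
Definition affine_isomorphic (I J : finType)
    (X : set (affine I)) (Y : set (affine J)) : Prop :=
  exists (f : J -> {mpoly F[#|I|]}) (g : I -> {mpoly F[#|J|]}),
    [/\ forall x, X x -> Y (poly_map f x),
        forall y, Y y -> X (poly_map g y),
        forall x, X x -> poly_map g (poly_map f x) = x
      & forall y, Y y -> poly_map f (poly_map g y) = y].

(* X * Y, inside the affine space with coordinates I + J. *)
Definition affine_product (I J : finType)
    (X : set (affine I)) (Y : set (affine J)) : set (affine (I + J)%type) :=
  [set z : affine (I + J)%type |
    X [ffun i => z (inl i)] /\ Y [ffun j => z (inr j)]].

End AffineGeometry.

Section LabelledComplexes.
Variables (V : finType) (n : nat).
Implicit Types (Delta : {set {set V}}) (lab : V -> 'I_n).

(* V is exactly the set of vertices, whence the second clause. *)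
Definition simplicial_complex Delta : Prop :=
  [/\ finset.set0 \in Delta,
      forall v : V, [set v]%SET \in Delta
    & forall s t : {set V}, s \in Delta -> t \subset s -> t \in Delta].

Definition edge Delta : rel V := fun v w => [set v; w]%SET \in Delta.

Definition connected_complex Delta : Prop :=
  forall v w : V, connect (edge Delta) v w.

(* A multiset of labels is encoded by its multiplicities, as an exponent
   vector; mdeg is its cardinality. *)
Definition simplex_labels lab (s : {set V}) : 'X_{1..n} :=
  [multinom #|[set v in s | lab v == i]%SET| | i < n].

(* The simplices after identification; N is the cardinality of this set. *)
Definition classes Delta lab : {fset 'X_{1..n}} :=
  [fset simplex_labels lab s | s in Delta]%fset.

(* The simplices of dimension at least 1, i.e. with at least 2 vertices. *)
Definition classes_ge2 Delta lab : {fset 'X_{1..n}} :=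
  [fset m in classes Delta lab | (2 <= mdeg m)%N]%fset.

Variable F : fieldType.

(* The product of the t_i over the labels i in m, with multiplicity. *)
Definition label_prod (m : 'X_{1..n}) (t : affine F 'I_n) : F :=
  \prod_(i < n) t i ^+ m i.

(* sigma_2(V_Delta) *)
Definition secant_variety Delta lab : set (affine F (classes Delta lab)) :=
  zariski_closure
    [set x : affine F (classes Delta lab) |
     exists (p : F) (t u : affine F 'I_n),
       forall m : classes Delta lab,
         x m = p * label_prod (val m) t + (1 - p) * label_prod (val m) u].

(* The affine cone over T_Delta. *)
Definition toric_cone Delta lab : set (affine F (classes_ge2 Delta lab)) :=
  zariski_closure
    [set x : affine F (classes_ge2 Delta lab) |
     exists (s : F) (t : affine F 'I_n),
       forall m : classes_ge2 Delta lab, x m = s * label_prod (val m) t].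

End LabelledComplexes.

Arguments secant_variety {V n} F Delta lab.
Arguments toric_cone {V n} F Delta lab.

(* Main.v *)
(* A point of the parameterization lists the moments of a random vector X with
   value t with probability p and u with probability 1 - p.  Put mu = E X,
   d = t - u, P = p (1 - p) and q = 1 - 2 p.  The central moment of a multiset m
   of r labels is P h_r d^m, where h_2 = 1, h_3 = q and
   h_(r+2) = q h_(r+1) + P h_r.  Hence it is the secant cumulant P q^(r-2) d^m
   plus a polynomial in the secant cumulants of proper submultisets of m, and so
   the moments are obtained from the means and the secant cumulants by a
   triangular change of coordinates, which has a polynomial inverse.  For q != 0
   the secant cumulants form the point of the cone with parameters s = P / q^2
   and q d; conversely every (s, t) with 1 + 4 s != 0 arises, with
   q^2 = 1 / (1 + 4 s).  The exceptional values q = 0 and s = - 1 / 4 are isolated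
   on curves, hence harmless for Zariski closures. *)

Require Import Defs.
From mathcomp Require Import all_boot all_order all_algebra.
From mathcomp Require Import finmap classical_sets reals mpoly complex.
From mathcomp Require Import ring.

Set Implicit Arguments.
Unset Strict Implicit.
Unset Printing Implicit Defensive.

(** * Polynomial functions and maps, and Zariski closed sets *)

Section RegularFunctions.
Import GRing.Theory.
Local Open Scope ring_scope.
Local Open Scope classical_set_scope.
Variable F : fieldType.
Implicit Types I J K : finType.

(** Polynomiality is a property of functions here, so that maps can be composed without substituting
    polynomials; [regular_mapP] recovers actual polynomials. *)
Definition regular I (h : affine F I -> F) : Prop :=
  exists p : {mpoly F[#|I|]}, forall x, poly_eval p x = h x.

Definition regular_map I J (f : affine F I -> affine F J) : Prop :=
  forall j, regular (fun x => f x j).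

Lemma eq_regular I (g h : affine F I -> F) : g =1 h -> regular g -> regular h.
Proof. by move=> gh [p pg]; exists p => x; rewrite pg gh. Qed.

Lemma regular_cst I (c : F) : regular (fun _ : affine F I => c).
Proof. by exists c%:MP => x; rewrite /poly_eval mevalC. Qed.

Lemma regular_coord I (i : I) : regular (fun x : affine F I => x i).
Proof. by exists 'X_(enum_rank i) => x; rewrite /poly_eval mevalXU enum_rankK. Qed.

Lemma regularD I (g h : affine F I -> F) :
  regular g -> regular h -> regular (fun x => g x + h x).
Proof.
by move=> [p pg] [q qh]; exists (p + q) => x; rewrite /poly_eval mevalD -pg -qh.
Qed.

Lemma regularM I (g h : affine F I -> F) :
  regular g -> regular h -> regular (fun x => g x * h x).
Proof.
by move=> [p pg] [q qh]; exists (p * q) => x; rewrite /poly_eval mevalM -pg -qh.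
Qed.

Lemma regularN I (g : affine F I -> F) : regular g -> regular (fun x => - g x).
Proof. by move=> [p pg]; exists (- p) => x; rewrite /poly_eval mevalN -pg. Qed.

Lemma regularX I (g : affine F I -> F) k :
  regular g -> regular (fun x => g x ^+ k).
Proof.
by move=> [p pg]; exists (p ^+ k) => x; rewrite /poly_eval rmorphXn /= -pg.
Qed.

Lemma regular_sum I (T : Type) (r : seq T) (g : T -> affine F I -> F) :
  (forall i, regular (g i)) -> regular (fun x => \sum_(i <- r) g i x).
Proof.
move=> rg; elim: r => [|i r IHr].
  by apply: eq_regular (regular_cst I 0) => x; rewrite big_nil.
by apply: eq_regular (regularD (rg i) IHr) => x; rewrite big_cons.
Qed.

Lemma regular_prod I (T : Type) (r : seq T) (g : T -> affine F I -> F) :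
  (forall i, regular (g i)) -> regular (fun x => \prod_(i <- r) g i x).
Proof.
move=> rg; elim: r => [|i r IHr].
  by apply: eq_regular (regular_cst I 1) => x; rewrite big_nil.
by apply: eq_regular (regularM (rg i) IHr) => x; rewrite big_cons.
Qed.

Lemma regular_comp I J (h : affine F J -> F) (f : affine F I -> affine F J) :
  regular h -> regular_map f -> regular (fun x => h (f x)).
Proof.
move=> [p ph] rf.
apply: (@eq_regular _ (fun x =>
  \sum_(m <- msupp p) p@_m * \prod_i f x (enum_val i) ^+ m i)).
  by move=> x; rewrite -ph /poly_eval mevalE.
apply: regular_sum => m; apply: regularM; first exact: regular_cst.
by apply: regular_prod => i; apply: regularX; apply: rf.
Qed.

Lemma regular_map_comp I J K (g : affine F J -> affine F K)
    (f : affine F I -> affine F J) :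
  regular_map g -> regular_map f -> regular_map (fun x => g (f x)).
Proof. by move=> rg rf k; apply: regular_comp (rg k) rf. Qed.

Lemma regular_mapP I J (f : affine F I -> affine F J) :
  regular_map f -> exists p : J -> {mpoly F[#|I|]}, poly_map p =1 f.
Proof.
move=> /fin_all_exists[p pf]; exists p => x.
by apply/ffunP => j; rewrite ffunE pf.
Qed.

Lemma zariski_closed_preimage I J (f : affine F I -> affine F J)
    (X : set (affine F J)) :
  regular_map f -> zariski_closed X -> zariski_closed (f @^-1` X).
Proof.
move=> rf [E ->].
(* Composition with [f] is known only as a function, so the equations are all polynomials that
   represent some [p] composed with [f]. *)
exists [set q | exists2 p, E p & forall x, poly_eval q x = poly_eval p (f x)].
apply/seteqP; split=> x /= Hx.
  by move=> q [p Ep ->]; apply: Hx.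
move=> p Ep.
have [q qE] : regular (fun x => poly_eval p (f x)).
  by apply: regular_comp rf; exists p.
by rewrite -qE; apply: Hx; exists p.
Qed.

(** The polynomials vanishing on [X] cut out the closure: the zero set of each is a closed set
    containing [X], and conversely every closed set containing [X] is defined by some of them. *)
Lemma zariski_closed_closure I (X : set (affine F I)) :
  zariski_closed (zariski_closure X).
Proof.
exists [set p | forall x, X x -> poly_eval p x = 0].
apply/seteqP; split=> x /= Hx.
  move=> p Hp; apply: (Hx [set x | poly_eval p x = 0]); split=> //.
  exists [set p]; apply/seteqP; split=> y /=; first by move=> ? q ->.
  by apply.
move=> A [[E ->] XA] /= p Ep; apply: Hx => y /XA; exact.
Qed.

Lemma zariski_closed_cst I (i : I) (c : F) :
  zariski_closed [set x : affine F I | x i = c].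
Proof.
have [p pE] : regular (fun x : affine F I => x i - c).
  by apply: regularD; [exact: regular_coord | exact: regular_cst].
exists [set p]; apply/seteqP; split=> x /=.
  by move=> xc q ->; rewrite pE xc subrr.
by move=> /(_ p erefl); rewrite pE => /eqP; rewrite subr_eq0 => /eqP.
Qed.

End RegularFunctions.

(** * Filling in one missing point of a polynomial curve *)

Section Curves.
Import GRing.Theory Num.Theory.
Local Open Scope ring_scope.
Local Open Scope classical_set_scope.
Variable F : numFieldType.

Lemma regular_line (h : affine F unit -> F) :
  regular h -> exists p : {poly F}, forall c, h [ffun=> c] = p.[c].
Proof.
move=> [p ph]; exists (\sum_(m <- msupp p) p@_m *: 'X^(mdeg m)) => c.
rewrite -ph /poly_eval mevalE horner_sum; apply: eq_bigr => m _.
rewrite hornerZ hornerXn mdegE -prodrXr; congr (_ * _).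
by apply: eq_bigr => i _; rewrite ffunE.
Qed.

Lemma poly_eq0_cofinite (p : {poly F}) (e : F) :
  (forall c, c != e -> p.[c] = 0) -> p = 0.
Proof.
move=> pe; apply/eqP; apply/negPn/negP => p0.
(* In characteristic 0 the points e + 1, e + 2, ... are distinct and avoid [e]; [size p] of them are
   too many roots. *)
pose rs := [seq e + k.+1%:R | k <- iota 0 (size p)].
suff /(max_poly_roots p0) : all (root p) rs.
  rewrite size_map size_iota ltnn => H; suff: false by []; apply: H.
  rewrite map_inj_uniq ?iota_uniq // => i j /addrI/eqP.
  by rewrite eqr_nat eqSS => /eqP.
apply/allP => _ /mapP[k _ ->]; apply/rootP; apply: pe.
by rewrite -subr_eq0 addrAC subrr add0r pnatr_eq0.
Qed.

(** An equation of [X] restricted to the curve is a univariate polynomial; vanishing away from [e],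
    it is zero. This removes the exceptional parameter values. *)
Lemma zariski_closed_curve (I : finType) (X : set (affine F I))
    (f : affine F unit -> affine F I) (e : F) :
  zariski_closed X -> regular_map f ->
  (forall c, c != e -> X (f [ffun=> c])) -> forall c, X (f [ffun=> c]).
Proof.
move=> [E ->] rf Xf c p Ep.
have /regular_line[q qE] : regular (fun x => poly_eval p (f x)).
  by apply: regular_comp rf; exists p.
rewrite qE (@poly_eq0_cofinite q e) ?horner0 // => b be.
by rewrite -qE; apply: Xf.
Qed.

End Curves.

(** * Triangular polynomial automorphisms of affine space *)

Section TriangularMaps.
Import GRing.Theory.
Local Open Scope ring_scope.
Variables (F : fieldType) (K : finType) (w : K -> nat).

(** Dependence on the coordinates of weight below [D] is stated extensionally, which avoids tracking
    the variables of a polynomial. *)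
Definition low_regular (D : nat) (h : affine F K -> F) : Prop :=
  regular h /\
  forall x y : affine F K, (forall k, (w k < D)%N -> x k = y k) -> h x = h y.

Lemma low_regular_cst D c : low_regular D (fun=> c).
Proof. by split=> //; apply: regular_cst. Qed.

Lemma low_regular_coord D k : (w k < D)%N -> low_regular D (fun x => x k).
Proof. by move=> kD; split=> [|x y]; [exact: regular_coord | apply]. Qed.

Lemma low_regularD D g h :
  low_regular D g -> low_regular D h -> low_regular D (fun x => g x + h x).
Proof.
move=> [rg lg] [rh lh]; split; first exact: regularD.
by move=> x y xy; rewrite (lg x y) ?(lh x y).
Qed.

Lemma low_regularM D g h :
  low_regular D g -> low_regular D h -> low_regular D (fun x => g x * h x).
Proof.
move=> [rg lg] [rh lh]; split; first exact: regularM.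
by move=> x y xy; rewrite (lg x y) ?(lh x y).
Qed.

Lemma low_regular_widen D D' h :
  (D <= D')%N -> low_regular D h -> low_regular D' h.
Proof.
move=> DD' [rh lh]; split=> // x y xy; apply: lh => k kD.
by apply: xy; apply: leq_trans DD'.
Qed.

Variable G : K -> affine F K -> F.
Hypothesis G_low : forall k, low_regular (w k) (G k).

Definition triangular (x : affine F K) : affine F K := [ffun k => x k + G k x].

Lemma triangular_regular : regular_map triangular.
Proof.
move=> k; apply: (@eq_regular _ _ (fun x => x k + G k x)).
  by move=> x; rewrite ffunE.
by apply: regularD; [exact: regular_coord | case: (G_low k)].
Qed.

(** Induction on the weight: where [x] and [y] agree below the weight of [k], the corrections [G k]
    are equal and cancel. *)
Lemma triangular_inj : injective triangular.
Proof.
move=> x y /ffunP xy.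
suff H D k : (w k < D)%N -> x k = y k by apply/ffunP => k; apply: (H (w k).+1).
elim: D k => // D IHD k kD.
have := xy k; rewrite !ffunE; suff -> : G k x = G k y by move=> /addIr.
by apply: (G_low k).2 => l lk; apply: IHD; exact: leq_trans lk kD.
Qed.

(* The inverse is the limit of x := y - G x, which stabilizes degree by
   degree. *)
Lemma triangular_inverse : exists f : affine F K -> affine F K,
  [/\ regular_map f, cancel f triangular & cancel triangular f].
Proof.
pose step (x y : affine F K) : affine F K := [ffun k => x k - G k y].
pose f D x := iter D (step x) x.
have rf D : regular_map (f D).
  elim: D => [|D IHD] k; first exact: regular_coord.
  apply: (@eq_regular _ _ (fun x => x k - G k (f D x))).
    by move=> x; rewrite /f /= ffunE.
  apply: regularD; first exact: regular_coord.
  by apply: regularN; apply: regular_comp IHD; case: (G_low k).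
have fS D x k : (w k < D)%N -> f D.+1 x k = f D x k.
  elim: D k => // D IHD k kD.
  rewrite {1}/f iterS -/(f _ _) {2}/f iterS -/(f _ _) !ffunE.
  congr (_ - _); apply: (G_low k).2 => l lk; apply: IHD.
  exact: leq_trans lk kD.
pose D := (\max_k w k).+1.
have fK : cancel (f D) triangular.
  move=> x; apply/ffunP => k; rewrite ffunE.
  have <- : f D.+1 x k = f D x k by apply: fS; rewrite ltnS leq_bigmax.
  by rewrite {1}/f iterS -/(f _ _) ffunE subrK.
exists (f D); split=> // x.
by apply: triangular_inj; rewrite fK.
Qed.

End TriangularMaps.

(** * Multisets of labels and their monomials *)

Section Multinomials.
Variable n : nat.
Implicit Types m k l : 'X_{1..n}.

Lemma mnm_ind1 (P : 'X_{1..n} -> Prop) :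
  P 0%MM -> (forall m i, P m -> P (m + U_(i))%MM) -> forall m, P m.
Proof.
move=> P0 PS m; have [D] := ubnP (mdeg m); elim: D m => // D IHD m mD.
have [->//|m0] := eqVneq m 0%MM.
have [i mi] : exists i, m i != 0.
  apply/existsP; apply: contraNT m0 => /existsPn m0; apply/eqP/mnmP => i.
  by rewrite mnm0E; apply/eqP/negbNE/m0.
have im : (U_(i) <= m)%MM.
  by apply/mnm_lepP => j; rewrite mnm1E; case: eqP => // <-; rewrite lt0n.
rewrite -(submK im); apply: PS; apply: IHD.
by move: mD; rewrite -{1}(submK im) mdegD mdeg1 addn1.
Qed.

Lemma mnm_split m D : D <= mdeg m -> exists k l, m = (k + l)%MM /\ mdeg k = D.
Proof.
elim/mnm_ind1: m => [|m i IHm].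
  by rewrite mdeg0 leqn0 => /eqP->; exists 0%MM, 0%MM; rewrite addm0 mdeg0.
rewrite mdegD mdeg1 addn1 leq_eqVlt => /predU1P[->|/IHm[k [l [-> <-]]]].
  by exists (m + U_(i))%MM, 0%MM; rewrite addm0 mdegD mdeg1 addn1.
by exists k, (l + U_(i))%MM; rewrite addmA.
Qed.

Lemma mdeg_eq1 m : mdeg m = 1 -> exists i, m = U_(i)%MM.
Proof.
elim/mnm_ind1: m => [|m i _]; first by rewrite mdeg0.
rewrite mdegD mdeg1 addn1 => -[] /eqP; rewrite mdeg_eq0 => /eqP->.
by exists i; rewrite add0m.
Qed.

Import GRing.Theory.
Local Open Scope ring_scope.
Variable F : fieldType.
Implicit Types t : affine F 'I_n.

Lemma label_prod0 t : label_prod 0%MM t = 1.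
Proof. by rewrite /label_prod big1 // => i _; rewrite mnm0E. Qed.

Lemma label_prodD m k t :
  label_prod (m + k)%MM t = label_prod m t * label_prod k t.
Proof.
by rewrite /label_prod -big_split; apply: eq_bigr => i _; rewrite mnmDE exprD.
Qed.

Lemma label_prod1 i t : label_prod U_(i)%MM t = t i.
Proof.
rewrite /label_prod (bigD1 i) //= mnm1E eqxx big1 ?mulr1 // => j ji.
by rewrite mnm1E eq_sym (negPf ji).
Qed.

Lemma label_prodZ m c t :
  label_prod m [ffun i => c * t i] = c ^+ mdeg m * label_prod m t.
Proof.
rewrite /label_prod mdegE -prodrXr -big_split; apply: eq_bigr => i _ /=.
by rewrite ffunE exprMn.
Qed.

End Multinomials.

(** * Multisets of labels that come from simplices *)

Section SimplexClasses.
Variables (V : finType) (n : nat) (Delta : {set {set V}}) (lab : V -> 'I_n).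
Hypothesis Delta_complex : simplicial_complex Delta.
Implicit Types m k l : 'X_{1..n}.

Lemma classes1 (v : V) : U_(lab v)%MM \in classes Delta lab.
Proof.
case: Delta_complex => _ D1 _; apply/imfsetP; exists [set v]%SET => //=.
apply/mnmP => i; rewrite mnm1E mnmE; case: eqP => [<-|vi]; apply/esym.
  apply: etrans (cards1 v); apply: eq_card => u.
  by rewrite !inE; case: eqP => // ->; rewrite eqxx.
apply/eqP; rewrite cards_eq0; apply/eqP/setP => u; rewrite !inE.
by apply/andP => -[/eqP-> /eqP].
Qed.

(** Labels are removed one at a time: a simplex whose multiset contains [i] has a vertex labelled
    [i], and deleting that vertex leaves a simplex. *)
Lemma classes_sub m k :
  (m + k)%MM \in classes Delta lab -> m \in classes Delta lab.
Proof.
elim/mnm_ind1: k => [|k i IHk]; first by rewrite addm0.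
rewrite addmA => mk; apply: IHk; move: (m + k)%MM mk => {k}m.
case/imfsetP => s /= sD mE.
have [v vs] : exists v, v \in [set v in s | lab v == i]%SET.
  apply/set0Pn; rewrite -card_gt0.
  have := congr1 (fun m : 'X_{1..n} => m i) mE.
  by rewrite /= mnmDE mnm1E mnmE eqxx addn1 => <-.
have /andP[sv /eqP vi] : (v \in s) && (lab v == i) by move: vs; rewrite inE.
apply/imfsetP; exists (s :\ v)%SET => /=.
  by case: Delta_complex => _ _; apply; first exact: sD; exact: subsetDl.
apply/mnmP => j; rewrite mnmE; apply: (@addIn (U_(i)%MM j)).
have := congr1 (fun m : 'X_{1..n} => m j) mE; rewrite /= mnmDE => ->.
rewrite mnm1E mnmE (cardsD1 v) addnC inE sv vi; congr (_ + _).
by apply: eq_card => u; rewrite !inE andbA.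
Qed.

End SimplexClasses.

(** * From moments to means and secant cumulants *)

Section SecantCumulants.
Import GRing.Theory.
Local Open Scope ring_scope.
Variables (V : finType) (n : nat) (Delta : {set {set V}}) (lab : V -> 'I_n).
Variable F : fieldType.
Hypothesis Delta_complex : simplicial_complex Delta.
Implicit Types m k l : 'X_{1..n}.

Notation C := (classes Delta lab).
Notation J := (classes_ge2 Delta lab).
Notation coords := ('I_n + J)%type.

Definition coord_degree (c : coords) : nat :=
  match c with inl _ => 1%N | inr m => mdeg (val m) end.

Section TwoPointMixture.
Variables (p : F) (t u : affine F 'I_n).

Definition label_mean i : F := p * t i + (1 - p) * u i.

Definition label_diff : affine F 'I_n := [ffun i => t i - u i].

(** The subtraction is truncated; the formula is meaningful for at least two labels. *)
Definition secant_cumulant m : F :=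
  p * (1 - p) * (1 - p *+ 2) ^+ (mdeg m - 2) * label_prod m label_diff.

Definition cumulant_point : affine F coords :=
  [ffun c => match c with
             | inl i => label_mean i
             | inr m => secant_cumulant (val m)
             end].

(* The expectation of [(X - mean)^k * X^l], where the random vector X takes the
   value t with probability p and the value u with probability 1 - p. *)
Definition mixed_moment k l : F :=
  p * (label_prod k [ffun i => t i - label_mean i] * label_prod l t)
  + (1 - p) * (label_prod k [ffun i => u i - label_mean i] * label_prod l u).

(* [p * (1 - p) * central_coef r * label_prod m label_diff] is the central
   moment of a multiset m of r + 2 labels. *)
Definition central_coef (r : nat) : F := (1 - p) ^+ r.+1 - (- p) ^+ r.+1.

(** Both 1 - p and - p are roots of X^2 - q X - P, with q = 1 - 2 p and P = p (1 - p). *)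
Lemma central_coefSS r :
  central_coef r.+2
  = (1 - p *+ 2) * central_coef r.+1 + p * (1 - p) * central_coef r.
Proof. by rewrite /central_coef !exprS; ring. Qed.

(** The deviations from the mean are (1 - p) d at t and - p d at u, where d = t - u. *)
Lemma mixed_moment0 m :
  mixed_moment m 0%MM
  = (p * (1 - p) ^+ mdeg m + (1 - p) * (- p) ^+ mdeg m) * label_prod m label_diff.
Proof.
rewrite /mixed_moment !label_prod0 !mulr1 [RHS]mulrDl -!mulrA -!label_prodZ.
congr (_ * label_prod m _ + _ * label_prod m _); apply/ffunP => i;
  by rewrite !ffunE /label_mean; ring.
Qed.

(** Writing X_i as (X_i - mean) + mean turns one raw factor into a centred one. *)
Lemma mixed_momentU k l i :
  mixed_moment k (l + U_(i))%MM
  = mixed_moment (k + U_(i))%MM l + label_mean i * mixed_moment k l.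
Proof. by rewrite /mixed_moment !label_prodD !label_prod1 !ffunE; ring. Qed.

Lemma mixed_moment0l m :
  mixed_moment 0%MM m = p * label_prod m t + (1 - p) * label_prod m u.
Proof. by rewrite /mixed_moment !label_prod0 !mul1r. Qed.

End TwoPointMixture.

(** A single polynomial [h] must serve all parameters, so that identities between parametrized
    quantities become polynomial maps on the space of cumulants. *)
Definition low_param (D : nat)
    (X : F -> affine F 'I_n -> affine F 'I_n -> F) : Prop :=
  exists h : affine F coords -> F, low_regular coord_degree D h /\
    forall p t u, X p t u = h (cumulant_point p t u).

Lemma eq_low_param D X Y :
  (forall p t u, X p t u = Y p t u) -> low_param D X -> low_param D Y.
Proof. by move=> XY [h [lh Xh]]; exists h; split=> // p t u; rewrite -XY. Qed.

Lemma low_param_cst D c : low_param D (fun _ _ _ => c).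
Proof. by exists (fun=> c); split=> //; apply: low_regular_cst. Qed.

Lemma low_paramD D X Y : low_param D X -> low_param D Y ->
  low_param D (fun p t u => X p t u + Y p t u).
Proof.
move=> [g [lg Xg]] [h [lh Yh]]; exists (fun x => g x + h x).
by split=> [|p t u]; [exact: low_regularD | rewrite Xg Yh].
Qed.

Lemma low_paramM D X Y : low_param D X -> low_param D Y ->
  low_param D (fun p t u => X p t u * Y p t u).
Proof.
move=> [g [lg Xg]] [h [lh Yh]]; exists (fun x => g x * h x).
by split=> [|p t u]; [exact: low_regularM | rewrite Xg Yh].
Qed.

Lemma low_param_widen D D' X : (D <= D')%N -> low_param D X -> low_param D' X.
Proof.
by move=> DD' [h [lh Xh]]; exists h; split=> //; apply: low_regular_widen lh.
Qed.

Lemma low_param_mean D i :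
  (1 < D)%N -> low_param D (fun p t u => label_mean p t u i).
Proof.
move=> D1; exists (fun x => x (inl i)); split; last by move=> *; rewrite ffunE.
exact: low_regular_coord.
Qed.

Lemma low_param_cumulant D m : m \in C -> (1 < mdeg m < D)%N ->
  low_param D (fun p t u => secant_cumulant p t u m).
Proof.
move=> mC /andP[m2 mD].
have mJ : m \in J by rewrite !inE mC.
exists (fun x => x (inr [` mJ]%fset)); split; last by move=> *; rewrite ffunE.
exact: low_regular_coord.
Qed.

(* The term left over by [central_coefSS] factors as a central moment times a
   secant cumulant, m being split into parts with r + 2 and e + 2 labels. *)
Lemma low_param_central_coef r e m : m \in C -> mdeg m = (r + e).+2 ->
  low_param (mdeg m) (fun p t u =>
    p * (1 - p) * central_coef p r * (1 - p *+ 2) ^+ e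
      * label_prod m (label_diff t u)
    - secant_cumulant p t u m).
Proof.
have [D] := ubnP r; elim: D r e m => // D IHD [|[|r]] e m rD mC mdegm.
(* The coefficient is 1 for r = 0 and 1 - 2 p for r = 1, so in both cases the difference
   vanishes. *)
- apply: eq_low_param (low_param_cst _ 0) => p t u.
  by rewrite /secant_cumulant mdegm subSS subSS subn0 /central_coef; ring.
- apply: eq_low_param (low_param_cst _ 0) => p t u.
  rewrite /secant_cumulant mdegm subSS subSS subn0 /central_coef add1n !exprS.
  by ring.
have [k [l [mE degk]]] : exists k l, m = (k + l)%MM /\ mdeg k = r.+2.
  by apply: mnm_split; rewrite mdegm -!addnS leq_addr.
have degl : mdeg l = e.+2.
  by apply: (@addnI (mdeg k)); rewrite -mdegD -mE mdegm degk !addSn !addnS.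
have kC : k \in C by apply: (@classes_sub _ _ _ _ Delta_complex k l); rewrite -mE.
have lC : l \in C.
  by apply: (@classes_sub _ _ _ _ Delta_complex l k); rewrite addmC -mE.
(* The first summand is the case r + 1, e + 1 of the same [m]; the bracket is the case r, 0 of [k]
   with its cumulant added back. *)
apply: (@eq_low_param _ (fun p t u =>
   (p * (1 - p) * central_coef p r.+1 * (1 - p *+ 2) ^+ e.+1
      * label_prod m (label_diff t u) - secant_cumulant p t u m)
   + (p * (1 - p) * central_coef p r * (1 - p *+ 2) ^+ 0
      * label_prod k (label_diff t u) - secant_cumulant p t u k
      + secant_cumulant p t u k) * secant_cumulant p t u l)).
  move=> p t u; rewrite subrK central_coefSS.
  rewrite [secant_cumulant p t u l]/secant_cumulant degl.
  by rewrite subSS subSS subn0 mE label_prodD exprS; ring.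
apply: low_paramD.
  by apply: IHD; rewrite // mdegm !addSn addnS.
apply: low_paramM; last first.
  by apply: low_param_cumulant; rewrite // degl mdegm !addSn !ltnS -addSn leq_addl.
apply: low_paramD.
  apply: (@low_param_widen (mdeg k)).
    by rewrite mE mdegD leq_addr.
  by apply: IHD; rewrite ?addn0 //; apply: ltnW.
by apply: low_param_cumulant; rewrite // degk mdegm !addSn !ltnS leqW ?leq_addr.
Qed.

Lemma low_param_central m : m \in C -> (1 < mdeg m)%N ->
  low_param (mdeg m) (fun p t u =>
    mixed_moment p t u m 0%MM - secant_cumulant p t u m).
Proof.
move=> mC m2; have degm : mdeg m = (mdeg m - 2).+2 by rewrite -addn2 subnK.
apply: eq_low_param (@low_param_central_coef (mdeg m - 2) 0 m mC _).
  move=> p t u; rewrite mixed_moment0 {2 3}degm /central_coef !exprS.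
  by rewrite expr0; ring.
by rewrite addn0.
Qed.

(** This controls the lower-order factors in [low_param_moment]. The bound is one above the degree,
    as the cumulant of k + l itself may occur. *)
Lemma low_param_mixed k l : (k + l)%MM \in C ->
  low_param (mdeg (k + l)).+1 (fun p t u => mixed_moment p t u k l).
Proof.
elim/mnm_ind1: l k => [|l i IHl] k; last first.
  rewrite addmA => klC.
  have klC' := classes_sub Delta_complex klC.
  apply: eq_low_param (fun p t u => esym (mixed_momentU p t u k l i)) _.
  apply: low_paramD.
    by rewrite -addmA [(l + _)%MM]addmC addmA; apply: IHl;
       rewrite -addmA [(_ + l)%MM]addmC addmA.
  apply: low_paramM; first by apply: low_param_mean; rewrite mdegD mdeg1 addn1.
  by apply: low_param_widen (IHl _ klC'); rewrite !mdegD mdeg1 addn1.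
rewrite addm0 => kC.
case: (ltnP 1 (mdeg k)) => [k2|k1].
  apply: (@eq_low_param _ (fun p t u =>
    (mixed_moment p t u k 0%MM - secant_cumulant p t u k)
    + secant_cumulant p t u k)) => [p t u|]; first by rewrite subrK.
  apply: low_paramD; last by apply: low_param_cumulant; rewrite ?k2 /=.
  exact: low_param_widen (low_param_central kC k2).
(* The central moments of degree 0 and 1 are the constants 1 and 0. *)
case degk : (mdeg k) k1 => [|[|//]] _.
  apply: eq_low_param (low_param_cst _ 1) => p t u.
  have /eqP := degk; rewrite mdeg_eq0 => /eqP->.
  by rewrite mixed_moment0 mdeg0 label_prod0 !expr0; ring.
apply: eq_low_param (low_param_cst _ 0) => p t u.
by rewrite mixed_moment0 degk; ring.
Qed.

(** Centring the labels of [l] one by one adds only means times moments of smaller degree, so the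
    leading term stays that of the central moment. The case k = 0 gives the raw moments. *)
Lemma low_param_moment k l : (k + l)%MM \in C -> (1 < mdeg (k + l))%N ->
  low_param (mdeg (k + l)) (fun p t u =>
    mixed_moment p t u k l - secant_cumulant p t u (k + l)%MM).
Proof.
elim/mnm_ind1: l k => [|l i IHl] k.
  by rewrite addm0; apply: low_param_central.
rewrite addmA => klC kl2.
have kil : (k + U_(i) + l = k + l + U_(i))%MM.
  by rewrite -addmA [(_ + l)%MM]addmC addmA.
apply: (@eq_low_param _ (fun p t u =>
  (mixed_moment p t u (k + U_(i)) l - secant_cumulant p t u (k + U_(i) + l))
  + label_mean p t u i * mixed_moment p t u k l)) => [p t u|].
  by rewrite mixed_momentU kil; ring.
apply: low_paramD; first by rewrite -kil; apply: IHl; rewrite kil.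
apply: low_paramM; first exact: low_param_mean.
have := low_param_mixed (classes_sub Delta_complex klC).
by apply: low_param_widen; rewrite !mdegD mdeg1 addn1.
Qed.

Hypothesis lab_surj : forall i : 'I_n, exists v : V, lab v = i.

Lemma coord_class_subproof (c : coords) :
  match c with inl i => U_(i)%MM | inr m => val m end \in C.
Proof.
case: c => [i|m]; first by have [v <-] := lab_surj i; apply: classes1.
by have := valP m; rewrite !inE => /andP[].
Qed.

(** This matches the coordinates with the nonempty classes: [inl i] is the vertex class of label
    [i], and [inr m] a class with at least two labels. *)
Definition coord_class (c : coords) : C := [` coord_class_subproof c]%fset.

Lemma coord_class_inj : injective coord_class.
Proof.
have J2 (m : J) : (1 < mdeg (val m))%N.
  by have := valP m; rewrite !inE => /andP[].
move=> [i|m] [j|l] /(congr1 val) /= E.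
- have := congr1 (fun m : 'X_{1..n} => m i) E.
  by rewrite /= !mnm1E eqxx; case: eqP => // ->.
- by have := J2 l; rewrite /= -E mdeg1.
- by have := J2 m; rewrite /= E mdeg1.
- by congr inr; apply: val_inj.
Qed.

Lemma classP (m : C) : val m = 0%MM \/ exists c, m = coord_class c.
Proof.
case: (ltnP 1 (mdeg (val m))) => [m2|].
  have mJ : val m \in J by rewrite !inE m2 (valP m).
  by right; exists (inr [` mJ]%fset); apply: val_inj.
case degm : (mdeg (val m)) => [|[|//]] _.
  by left; apply/eqP; rewrite -mdeg_eq0 degm.
by right; have [i mi] := mdeg_eq1 degm; exists (inl i); apply: val_inj.
Qed.

Lemma coord_class_neq0 c : val (coord_class c) != 0%MM.
Proof.
rewrite -mdeg_eq0; case: c => [i|m] /=; first by rewrite mdeg1.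
by have := valP m; rewrite !inE => /andP[_]; case: (mdeg _).
Qed.

Definition secant_point (p : F) (t u : affine F 'I_n) : affine F C :=
  [ffun m => p * label_prod (val m) t + (1 - p) * label_prod (val m) u].

(** The two spaces differ by the coordinate of the empty simplex, which [f] forgets and [g] sets to
    1; hence the condition for [g] to invert [f]. *)
Lemma secant_change_of_coordinates :
  exists (f : affine F C -> affine F coords) (g : affine F coords -> affine F C),
  [/\ regular_map f, regular_map g, cancel g f,
      forall x : affine F C, (forall m : C, val m = 0%MM -> x m = 1) -> g (f x) = x
    & forall p t u, g (cumulant_point p t u) = secant_point p t u].
Proof.
(* Each moment is its own cumulant coordinate plus a polynomial in coordinates of lower degree: this
   is the triangular form. *)
have GP (c : coords) : exists h, low_regular coord_degree (coord_degree c) h /\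
    forall p t u, secant_point p t u (coord_class c)
      = cumulant_point p t u c + h (cumulant_point p t u).
  case: c => [i|m].
    exists (fun=> 0); split=> [|p t u]; first exact: low_regular_cst.
    by rewrite !ffunE !label_prod1 addr0.
  have /andP[mC m2] : (val m \in C) && (1 < mdeg (val m))%N.
    by have := valP m; rewrite !inE.
  have := @low_param_moment 0%MM (val m); rewrite add0m => /(_ mC m2)[h [lh hE]].
  exists h; split=> // p t u.
  by rewrite -hE mixed_moment0l !ffunE /= [RHS]addrC subrK.
have [G GE] := fin_all_exists GP.
have Glow c := (GE c).1.
have [f0 [rf0 f0K Kf0]] := triangular_inverse Glow.
pose restr (x : affine F C) : affine F coords := [ffun c => x (coord_class c)].
(* Only the empty class is missed by [coord_class], so the default 1 is the value of its
   coordinate. *)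
pose g (z : affine F coords) : affine F C :=
  [ffun m => if [pick c | coord_class c == m] is Some c
             then triangular G z c else 1].
have g_class z c : g z (coord_class c) = triangular G z c.
  rewrite [LHS]ffunE; case: pickP => [d /eqP/coord_class_inj-> //|/(_ c)].
  by rewrite eqxx.
have g_empty z (m : C) : val m = 0%MM -> g z m = 1.
  rewrite [g z m]ffunE; case: pickP => // c /eqP <- /eqP.
  by rewrite (negPf (coord_class_neq0 c)).
have restr_g z : restr (g z) = triangular G z.
  by apply/ffunP => c; rewrite ffunE g_class.
have restr_regular : regular_map restr.
  move=> c; apply: (@eq_regular _ _ (fun x => x (coord_class c))).
    by move=> x; rewrite ffunE.
  exact: regular_coord.
exists (fun x => f0 (restr x)), g; split.
- exact: regular_map_comp.
- move=> m; case: (classP m) => [m0|[c ->]].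
    by apply: eq_regular (regular_cst _ 1) => z; rewrite g_empty.
  apply: eq_regular (triangular_regular Glow c) => z.
  by rewrite g_class.
- by move=> z; rewrite restr_g Kf0.
- move=> x x1; apply/ffunP => m; case: (classP m) => [m0|[c ->]].
    by rewrite g_empty // x1.
  by rewrite g_class f0K ffunE.
- move=> p t u; apply/ffunP => m; case: (classP m) => [m0|[c ->]].
    by rewrite g_empty // ffunE m0 !label_prod0; ring.
  by rewrite g_class (GE c).2 ffunE.
Qed.


End SecantCumulants.

(** * Comparison of the secant variety with the cone *)

Section SecantVariety.
Import GRing.Theory Num.Theory.
Local Open Scope ring_scope.
Local Open Scope classical_set_scope.
Variables (V : finType) (n : nat) (Delta : {set {set V}}) (lab : V -> 'I_n).
Variable F : numClosedFieldType.
Hypothesis Delta_complex : simplicial_complex Delta.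

Notation C := (classes Delta lab).
Notation J := (classes_ge2 Delta lab).

Lemma classes_ge2_degree (m : J) : mdeg (val m) = (mdeg (val m) - 2 + 2)%N.
Proof. by rewrite subnK //; have := valP m; rewrite !inE => /andP[]. Qed.

(** The power of [q] completes to one factor [q] per label, which is absorbed into the vector
    [d]. *)
Lemma toric_cone_rescale (s q : F) (d : affine F 'I_n) (m : J) : q != 0 ->
  s * q ^+ 2 * q ^+ (mdeg (val m) - 2) * label_prod (val m) d
  = s * label_prod (val m) [ffun i => q * d i].
Proof.
move=> q0; rewrite label_prodZ [in RHS]classes_ge2_degree exprD.
by ring.
Qed.

(** Since p (1 - p) = (1 - q^2) / 4, for fixed [d] the cumulants trace a polynomial curve in q = 1 -
    2 p. It lies in the cone for q != 0, hence also at q = 0, that is p = 1/2. *)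
Lemma cumulants_in_toric_cone (p : F) (t u : affine F 'I_n) :
  toric_cone F Delta lab
    [ffun m => cumulant_point Delta lab p t u (inr m)].
Proof.
pose d := label_diff t u.
pose curve (x : affine F unit) : affine F J :=
  [ffun m => (1 - x tt ^+ 2) / 4%:R * x tt ^+ (mdeg (val m) - 2)
             * label_prod (val m) d].
have curve_regular : regular_map curve.
  move=> m; apply: (@eq_regular _ _ (fun x => (1 - x tt ^+ 2) * 4%:R^-1
      * x tt ^+ (mdeg (val m) - 2) * label_prod (val m) d)).
    by move=> x; rewrite ffunE.
  have x_regular := @regular_coord F _ tt.
  apply: regularM; last exact: regular_cst.
  apply: regularM; last exact: regularX.
  apply: regularM; last exact: regular_cst.
  apply: regularD; first exact: regular_cst.
  by apply: regularN; apply: regularX.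
have curve_cone c : c != 0 -> toric_cone F Delta lab (curve [ffun=> c]).
  move=> c0; apply: sub_smallest; first exact: subset_refl.
  exists ((1 - c ^+ 2) / 4%:R / c ^+ 2), [ffun i => c * d i] => m.
  by rewrite -toric_cone_rescale // !ffunE divfK ?expf_neq0.
have := zariski_closed_curve (zariski_closed_closure _) curve_regular curve_cone.
move=> /(_ (1 - p *+ 2)); congr (toric_cone _ _ _ _); apply/ffunP => m.
rewrite !ffunE /secant_cumulant /=; congr (_ * _ * _).
by field.
Qed.

(** This solves s = P / q^2 for [p]: as q^2 = 1 - 4 P, one needs q^2 = 1 / (1 + 4 s), hence a square
    root. *)
Lemma toric_cone_cumulants (s : F) (a t : affine F 'I_n) : 1 + s *+ 4 != 0 ->
  exists p (t' u' : affine F 'I_n), cumulant_point Delta lab p t' u' =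
    [ffun c => match c with
               | inl i => a i
               | inr m => s * label_prod (val m) t
               end].
Proof.
move=> s0; pose r := sqrtC (1 + s *+ 4).
have r0 : r != 0 by rewrite sqrtC_eq0.
have r2 : r ^+ 2 = 1 + s *+ 4 by rewrite sqrtCK.
pose q := r^-1; pose p := (1 - q) / 2%:R.
have qp : 1 - p *+ 2 = q by rewrite /p; field.
have pq : p * (1 - p) = s * q ^+ 2.
  have -> : s = (r ^+ 2 - 1) / 4%:R.
    by rewrite r2; field.
  by rewrite /p /q; field.
pose d : affine F 'I_n := [ffun i => r * t i].
(* These two points have mean [a] and difference [d], and q d = t because q r = 1. *)
exists p, [ffun i => a i + (1 - p) * d i], [ffun i => a i - p * d i].
apply/ffunP => -[i|m]; rewrite !ffunE.
  by rewrite /label_mean !ffunE; ring.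
rewrite /secant_cumulant qp pq.
have -> : label_diff [ffun i => a i + (1 - p) * d i] [ffun i => a i - p * d i] = d.
  by apply/ffunP => i; rewrite !ffunE; ring.
rewrite toric_cone_rescale ?invr_eq0 //; congr (_ * label_prod _ _).
by apply/ffunP => i; rewrite !ffunE mulKf.
Qed.

Hypothesis lab_surj : forall i : 'I_n, exists v : V, lab v = i.

Lemma secant_variety_isomorphic :
  affine_isomorphic (secant_variety F Delta lab)
    (affine_product (setT : set (affine F 'I_n)) (toric_cone F Delta lab)).
Proof.
have [f [g [rf rg gK fK g_cumulant]]] :=
  secant_change_of_coordinates F Delta_complex lab_surj.
have secant_closed := zariski_closed_closure
  [set x : affine F C | exists (p : F) (t u : affine F 'I_n),
     forall m : C, x m = p * label_prod (val m) t + (1 - p) * label_prod (val m) u].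
have cone_closed := zariski_closed_closure
  [set x : affine F J | exists (s : F) (t : affine F 'I_n),
     forall m : J, x m = s * label_prod (val m) t].
have secant_empty x : secant_variety F Delta lab x ->
    forall m : C, val m = 0%MM -> x m = 1.
  move=> secx m m0; apply: (secx [set x : affine F C | x m = 1]).
  split; first exact: zariski_closed_cst.
  by move=> y [p [t [u yE]]] /=; rewrite yE m0 !label_prod0; ring.
have f_cone x : secant_variety F Delta lab x ->
    toric_cone F Delta lab [ffun m => f x (inr m)].
  pose h x : affine F J := [ffun m => f x (inr m)].
  have rh : regular_map h.
    by move=> m; apply: eq_regular (rf (inr m)) => y; rewrite ffunE.
  (* The preimage of the cone is closed, so checking the parametrized points suffices. *)
  move=> secx; apply: (secx (h @^-1` toric_cone F Delta lab)); split.
    exact: zariski_closed_preimage.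
  move=> y [p [t [u yE]]] /=.
  have -> : y = secant_point Delta lab p t u by apply/ffunP => m; rewrite ffunE.
  rewrite /h -g_cumulant gK; exact: cumulants_in_toric_cone.
have g_secant (a : affine F 'I_n) (y : affine F J) : toric_cone F Delta lab y ->
    secant_variety F Delta lab
      (g [ffun c => match c with inl i => a i | inr m => y m end]).
  pose join (y : affine F J) : affine F ('I_n + J)%type :=
    [ffun c => match c with inl i => a i | inr m => y m end].
  have r_join : regular_map join.
    move=> [i|m].
      apply: (@eq_regular _ _ (fun=> a i)) => [x|]; first by rewrite ffunE.
      exact: regular_cst.
    apply: (@eq_regular _ _ (fun x => x m)) => [x|]; first by rewrite ffunE.
    exact: regular_coord.
  (* With the means [a] fixed, the cone points sent into the secant variety form a closed set; again
     the parametrized ones suffice. *)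
  have W_closed := zariski_closed_preimage (regular_map_comp rg r_join) secant_closed.
  move=> coney; apply: (coney _ (conj W_closed _)) => {coney}y [s [t yE]].
  pose curve (x : affine F unit) : affine F J :=
    [ffun m => x tt * label_prod (val m) t].
  have curve_regular : regular_map curve.
    move=> m; apply: (@eq_regular _ _ (fun x => x tt * label_prod (val m) t)).
      by move=> x; rewrite ffunE.
    by apply: regularM; [exact: regular_coord | exact: regular_cst].
  have -> : y = curve [ffun=> s] by apply/ffunP => m; rewrite !ffunE yE.
  (* Along the line in [s] with [t] fixed, only s = - 1 / 4 is not reached by cumulants. *)
  apply: (zariski_closed_curve (e := - 4%:R^-1) W_closed curve_regular) => c c4.
  have c4' : 1 + c *+ 4 != 0.
    apply: contra_neq c4 => c4; apply: (@mulIf _ 4%:R); first by rewrite pnatr_eq0.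
    rewrite mulNr mulVf ?pnatr_eq0 // mulr_natr.
    by apply/eqP; rewrite -addr_eq0 addrC c4.
  have [p [t' [u' E]]] := toric_cone_cumulants a t c4'.
  have gE : g (join (curve [ffun=> c])) = secant_point Delta lab p t' u'.
    by rewrite -g_cumulant E; congr g; apply/ffunP => -[i|m]; rewrite !ffunE.
  rewrite /preimage /= gE.
  apply: sub_smallest; first exact: subset_refl.
  by exists p, t', u' => m; rewrite ffunE.
have [pf pfE] := regular_mapP rf; have [pg pgE] := regular_mapP rg.
exists pf, pg; split=> [x secx|z [_ conez]|x secx|z _].
- by split=> //; rewrite pfE; apply: f_cone.
- rewrite pgE; have := g_secant [ffun i => z (inl i)] _ conez.
  congr (secant_variety _ _ _ (g _)); by apply/ffunP => -[i|m]; rewrite !ffunE.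
- by rewrite pfE pgE fK //; apply: secant_empty.
- by rewrite pgE pfE gK.
Qed.

End SecantVariety.

Theorem theorem2p8 (R : realType) (V : finType) (n : nat)
    (Delta : {set {set V}}) (lab : V -> 'I_n)
    (Delta_complex : simplicial_complex Delta)
    (Delta_connected : connected_complex Delta)
    (lab_surj : forall i : 'I_n, exists v : V, lab v = i) :
  affine_isomorphic
    (secant_variety R[i]%C Delta lab)
    (affine_product (setT : set (affine R[i]%C 'I_n))
                    (toric_cone R[i]%C Delta lab)).
Proof. exact: secant_variety_isomorphic. Qed.
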